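(* Let $F,G:\mathbb{R}^q\times\mathbb{R}^q\to\mathbb{R}^q$, $(U,M)\mapsto F(U,M),\,G(U,M)$, be continuously differentiable, and let $(U^*,M^* )$ satisfy $F(U^*,M^* )=0$ and $G(U^*,M^* )=0$. Put $$F_u:=\frac{\partial F}{\partial U}(U^*,M^* ),\quad F_m:=\frac{\partial F}{\partial M}(U^*,M^* ),\quad G_u:=\frac{\partial G}{\partial U}(U^*,M^* ),\quad G_m:=\frac{\partial G}{\partial M}(U^*,M^* ),$$ and assume that $F_u$ and $G_m$ are invertible. Let $\alpha\in(0,1]$ be a relaxation factor and consider the relaxed alternating sweeping iteration: given $(U_{k-1},M_{k-1})$, - let $U_{\mathrm{new}}$ solve $F(U_{\mathrm{new}},M_{k-1})=0$ and set $U_k=\alpha U_{\mathrm{new}}+(1-\alpha)U_{k-1}$; - let $M_{\mathrm{new}}$ solve $G(U_k,M_{\mathrm{new}})=0$ and set $M_k=\alpha M_{\mathrm{new}}+(1-\alpha)M_{k-1}$. Suppose that $$\left|\lambda_{\max}(G_m^{-1}G_uF_u^{-1}F_m)\right|<1,$$ where $\lambda_{\max}$ denotes the eigenvalue of largest modulus. If $\alpha$ satisfies $$0<\alpha<\frac{2}{1+\rho(G_m^{-1}G_uF_u^{-1}F_m)},$$ where $\rho$ is the spectral radius, then the relaxed iteration converges locally to $(U^*,M^* )$.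
   Context: In the application, $U,M\in\mathbb{R}^q$ collect all values of two grid functions on a space-time mesh; $F(U,M)=0$ is the discretized forward Hamilton-Jacobi-Bellman equation and $G(U,M)=0$ the discretized backward Kolmogorov-Fokker-Planck equation of a mean field game. The statement uses only the listed assumptions on $F$ and $G$. Conventions. Since $F_u$ and $G_m$ are invertible, for $M$ near $M^*$ the equation $F(U,M)=0$ has a unique solution $U$ near $U^*$, and for $U$ near $U^*$ the equation $G(U,M)=0$ has a unique solution $M$ near $M^*$; the steps of the iteration refer to these local solutions. ''Converges locally'' means: there is a neighbourhood of $(U^*,M^* )$ such that for every initial pair $(U_0,M_0)$ in it the iterates are well defined and $(U_k,M_k)\to(U^*,M^* )$ as $k\to\infty$. *)

(* Defs.v *)
From HB Require Import structures.
From mathcomp Require Export all_boot all_order all_algebra.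
From mathcomp Require Export complex.
From mathcomp Require Export all_classical all_reals all_analysis.

Set Implicit Arguments.
Unset Strict Implicit.
Unset Printing Implicit Defensive.

Import Order.TTheory GRing.Theory Num.Theory.
Import numFieldNormedType.Exports.

Local Open Scope classical_set_scope.
Local Open Scope ring_scope.

(* [jacobian] acts on row vectors from the right ('d f p v = v *m jacobian f p),
   so it is transposed here: entry (i, j) is the partial derivative of the
   i-th component with respect to the j-th coordinate. *)
Definition partial1 (R : realType) (q : nat)
    (F : 'rV[R]_q * 'rV[R]_q -> 'rV[R]_q) (z : 'rV[R]_q * 'rV[R]_q) : 'M[R]_q :=
  (jacobian (fun U => F (U, z.2)) z.1)^T.

Definition partial2 (R : realType) (q : nat)
    (F : 'rV[R]_q * 'rV[R]_q -> 'rV[R]_q) (z : 'rV[R]_q * 'rV[R]_q) : 'M[R]_q :=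
  (jacobian (fun M => F (z.1, M)) z.2)^T.

(* The matrix of the Frechet derivative at z is the block row
   (partial1 F z, partial2 F z), so its continuity is that of the two blocks. *)
Definition continuously_differentiable (R : realType) (q : nat)
    (F : 'rV[R]_q * 'rV[R]_q -> 'rV[R]_q) : Prop :=
  [/\ forall z, differentiable F z,
      continuous (partial1 F) & continuous (partial2 F)].

Definition complex_eigenvalue (R : realType) (q : nat) (A : 'M[R]_q) : pred R[i] :=
  eigenvalue (map_mx (real_complex R) A).

(* The norm of R[i] takes its (real) values in R[i]; [complex.Re] brings them
   back to R. *)
Definition cmodulus (R : realType) (z : R[i]) : R := complex.Re `|z|.

Definition largest_eigenvalue (R : realType) (q : nat) (A : 'M[R]_q)
    (l : R[i]) : Prop :=
  complex_eigenvalue A l /\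
  forall l', complex_eigenvalue A l' -> cmodulus l' <= cmodulus l.

Definition spectral_radius (R : realType) (q : nat) (A : 'M[R]_q) : R :=
  sup [set cmodulus l | l in [set l : R[i] | complex_eigenvalue A l]].

(* On the neighbourhoods P of p0 and X of x0, the equation H p x = 0 defines x
   as a function of p. *)
Definition local_resolution (R : realType) (q : nat)
    (H : 'rV[R]_q -> 'rV[R]_q -> 'rV[R]_q) (p0 x0 : 'rV[R]_q)
    (P X : set 'rV[R]_q) : Prop :=
  [/\ nbhs p0 P, nbhs x0 X &
      forall p, P p -> exists! x, X x /\ H p x = 0].

(* One sweep is possible only if each equation is posed with its parameter in
   the set where it is uniquely solvable: M in PF, with solution taken in XF,
   and then the new U in PG, with solution taken in XG. *)
Definition relaxed_sweep (R : realType) (q : nat)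
    (F G : 'rV[R]_q * 'rV[R]_q -> 'rV[R]_q) (alpha : R)
    (PF XF PG XG : set 'rV[R]_q) (z z' : 'rV[R]_q * 'rV[R]_q) : Prop :=
  exists Unew Mnew : 'rV[R]_q,
    [/\ PF z.2, XF Unew & F (Unew, z.2) = 0] /\
    z'.1 = alpha *: Unew + (1 - alpha) *: z.1 /\
    [/\ PG z'.1, XG Mnew & G (z'.1, Mnew) = 0] /\
    z'.2 = alpha *: Mnew + (1 - alpha) *: z.2.

Definition sweeping_iteration (R : realType) (q : nat)
    (F G : 'rV[R]_q * 'rV[R]_q -> 'rV[R]_q) (alpha : R)
    (PF XF PG XG : set 'rV[R]_q) (z0 : 'rV[R]_q * 'rV[R]_q)
    (z : nat -> 'rV[R]_q * 'rV[R]_q) : Prop :=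
  z 0%N = z0 /\
  forall k, relaxed_sweep F G alpha PF XF PG XG (z k) (z k.+1).

Definition converges_locally (R : realType) (q : nat)
    (F G : 'rV[R]_q * 'rV[R]_q -> 'rV[R]_q) (alpha : R)
    (PF XF PG XG : set 'rV[R]_q) (zs : 'rV[R]_q * 'rV[R]_q) : Prop :=
  exists2 N : set ('rV[R]_q * 'rV[R]_q), nbhs zs N &
    forall z0, N z0 ->
      (exists z, sweeping_iteration F G alpha PF XF PG XG z0 z) /\
      (forall z, sweeping_iteration F G alpha PF XF PG XG z0 z ->
        z @ \oo --> zs).

(* Main.v *)
(* Linearizing a sweep at (Us, Ms) gives, on row vectors of deviations (u, m),
     u' = (1 - alpha) u - alpha m A,   m' = (1 - alpha) m - alpha u' C,
   with A = Fm^T Fu^-T and C = Gu^T Gm^-T, so that A C is the transpose of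
   Gm^-1 Gu Fu^-1 Fm.  An eigenvalue mu of this map either equals 1 - alpha or
   satisfies (mu - (1 - alpha))^2 = alpha^2 lambda mu for an eigenvalue lambda
   of A C; when |lambda| < 1 and 0 < alpha <= 1 this forces |mu| < 1.  Hence,
   by triangularization, the linearized sweep contracts some norm N on R^(2q).
   The nonlinear sweep differs from it by o(|(u, m)|), whichever local
   resolutions are used, and therefore contracts N near (Us, Ms). *)

Require Import Defs.
From HB Require Import structures.
From mathcomp Require Import spectral lra ring.

Set Implicit Arguments.
Unset Strict Implicit.
Unset Printing Implicit Defensive.

Import Order.TTheory GRing.Theory Num.Theory.
Import numFieldNormedType.Exports.
Local Open Scope classical_set_scope.
Local Open Scope ring_scope.

(** * Entrywise bounds for the max norm of matrices *)

Lemma mx_norm_ge_coord (R : realType) (m n : nat) (A : 'M[R]_(m, n)) i j :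
  `|A i j| <= `|A|.
Proof.
rewrite [leRHS]/Num.norm /= mx_normrE.
by apply/bigmax_geP; right => /=; exists (i, j).
Qed.

Lemma mx_norm_le (R : realType) (m n : nat) (A : 'M[R]_(m, n)) (e : R) :
  0 <= e -> (forall i j, `|A i j| <= e) -> `|A| <= e.
Proof.
move=> e0 ve; rewrite [leLHS]/Num.norm /= mx_normrE.
by apply/bigmax_leP; split => // -[i j] _ /=.
Qed.

(** * Adapted norms and the linearized sweep *)

Lemma cmodulus_ge0 (R : realType) (z : R[i]) : 0 <= cmodulus z.
Proof. by case: z => a b; rewrite /cmodulus /= sqrtr_ge0. Qed.

Lemma cmodulus0 (R : realType) : cmodulus (0 : R[i]) = 0.
Proof. by rewrite /cmodulus normr0. Qed.

Lemma cmodulusM (R : realType) (x y : R[i]) :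
  cmodulus (x * y) = cmodulus x * cmodulus y.
Proof. exact: Normc.normcM. Qed.

Lemma cmodulusD (R : realType) (x y : R[i]) :
  cmodulus (x + y) <= cmodulus x + cmodulus y.
Proof. exact: le_normcD. Qed.

Lemma cmodulus_real (R : realType) (x : R) : cmodulus x%:C%C = `|x|.
Proof. by rewrite /cmodulus /= expr0n addr0 sqrtr_sqr. Qed.

Lemma cmodulus_sum (R : realType) (I : finType) (f : I -> R[i]) :
  cmodulus (\sum_i f i) <= \sum_i cmodulus (f i).
Proof.
elim/big_ind2: _ => [|x a y b xa yb|//]; first by rewrite cmodulus0.
by apply: le_trans (lerD xa yb); apply: cmodulusD.
Qed.

Lemma cmodulus_mulmx (R : realType) (n : nat) (v : 'rV[R[i]]_n)
    (M : 'M[R[i]]_n) (j : 'I_n) :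
  cmodulus ((v *m M) 0 j) <= \sum_i cmodulus (v 0 i) * cmodulus (M i j).
Proof.
rewrite mxE; apply: le_trans (cmodulus_sum _) _; rewrite ler_sum// => i _.
by rewrite cmodulusM.
Qed.

(** Schur's theorem, with unitarity weakened to invertibility. It asks for positive size, so the
    empty matrix is treated apart. *)
Lemma triangularization (R : realType) (n : nat) (A : 'M[R[i]]_n) :
  exists2 P : 'M[R[i]]_n, P \in unitmx & is_trig_mx (P *m A *m invmx P).
Proof.
case: n A => [|n] A.
  by exists 1%:M; rewrite ?unitmx1//; apply/is_trig_mxP => -[].
have [P Pu] := Schur A isT.
have Pun := unitarymx_unit Pu.
by rewrite /similar_to conjumx// => PA; exists P.
Qed.

(* With weights t ^ j that grow fast enough, the off-diagonal part of a lower
   triangular matrix is negligible in the weighted l1 norm. *)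
Lemma triangular_contraction (R : realType) (n : nat) (L : 'M[R[i]]_n) :
  is_trig_mx L -> (forall i, cmodulus (L i i) < 1) ->
  exists t c : R, [/\ 1 <= t, 0 <= c < 1 & forall w : 'rV[R[i]]_n,
    \sum_(j < n) t ^+ j * cmodulus ((w *m L) 0 j) <=
    c * \sum_(j < n) t ^+ j * cmodulus (w 0 j)].
Proof.
move=> /is_trig_mxP Ltrig Ldiag.
pose d := \big[Num.max/0]_i cmodulus (L i i).
have d0 : 0 <= d by exact: bigmax_ge_id.
have d1 : d < 1 by apply/bigmax_ltP; split.
pose S := \sum_i \sum_j cmodulus (L i j).
have S0 : 0 <= S.
  by rewrite sumr_ge0// => i _; rewrite sumr_ge0// => j _; exact: cmodulus_ge0.
(* The off-diagonal part will cost at most [S / t], and this [t] makes [S / t] smaller than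
   [1 - d]. *)
pose t := 1 + 2 * S / (1 - d); pose c := d + S / t.
have t1 : 1 <= t by rewrite lerDl divr_ge0 ?mulr_ge0// subr_ge0 ltW.
have t0 : 0 < t := lt_le_trans ltr01 t1.
exists t, c; split=> [//||w].
  rewrite addr_ge0 ?divr_ge0 ?(ltW t0)//=.
  rewrite -ltrBrDl ltr_pdivrMr// /t mulrDr mulr1 mulrCA.
  rewrite mulfV ?gt_eqF ?subr_gt0//.
  by lra.
rewrite mulr_sumr.
apply: (@le_trans _ _ (\sum_(j < n) \sum_i
   cmodulus (w 0 i) * (t ^+ j * cmodulus (L i j)))).
  apply: ler_sum => j _.
  apply: le_trans (ler_wpM2l _ (cmodulus_mulmx _ _ _)) _.
    by rewrite exprn_ge0// ltW.
  by rewrite mulr_sumr ler_sum// => i _; rewrite mulrCA.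
(* For each [i] it remains to bound the weighted sum of row [i] of [L] by [c * t ^+ i]: the diagonal
   entry contributes [d], the others [S / t]. *)
rewrite exchange_big ler_sum//= => i _; rewrite -mulr_sumr.
rewrite [leRHS]mulrA [leRHS]mulrC ler_wpM2l ?cmodulus_ge0//.
rewrite (bigD1 i)//= /c mulrDl lerD//.
  by rewrite mulrC ler_wpM2r ?exprn_ge0 ?(ltW t0)//; exact: le_bigmax.
(* Only entries with j < i survive, and there t^j <= t^(i-1). *)
have offdiag j : j != i ->
    t ^+ j * cmodulus (L i j) <= t^-1 * t ^+ i * cmodulus (L i j).
  move=> ji; have [ij|] := ltnP i j.
    by rewrite Ltrig// cmodulus0 !mulr0.
  rewrite leq_eqVlt (negbTE ji : (j == i :> nat) = false) /= => lji.
  rewrite ler_wpM2r ?cmodulus_ge0// ler_pdivlMl// -exprS ler_weXn2l//.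
rewrite (le_trans (ler_sum _ offdiag))// -mulr_sumr [S / t]mulrC -mulrA.
rewrite -[leRHS]mulrA ler_wpM2l ?invr_ge0 ?(ltW t0)//.
rewrite [leRHS]mulrC ler_wpM2l ?exprn_ge0 ?(ltW t0)//.
have Spos k : 0 <= \sum_j cmodulus (L k j).
  by rewrite sumr_ge0// => j _; exact: cmodulus_ge0.
rewrite /S [leRHS](bigD1 i)//= [X in _ <= X + _](bigD1 i)//= addrAC.
by rewrite lerDr addr_ge0 ?cmodulus_ge0// sumr_ge0.
Qed.
(** [N] is the weighted l1 norm of the coordinates of [v] in a complex basis that triangularizes
    [T]. The two bounds by [K] let estimates pass between [N] and the max norm. *)
Lemma adapted_norm (R : realType) (n : nat) (T : 'M[R]_n) :
  (forall l, complex_eigenvalue T l -> cmodulus l < 1) ->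
  exists (N : 'rV[R]_n -> R) (c K : R),
    [/\ 0 <= c < 1, 0 < K, forall v w, N (v + w) <= N v + N w,
        forall v, N (v *m T) <= c * N v &
        forall v, N v <= K * `|v| /\ `|v| <= K * N v].
Proof.
move=> Teig; pose TC := map_mx (real_complex R) T.
have [P Pu Ptrig] := triangularization TC.
set L := P *m TC *m invmx P in Ptrig.
(* Diagonal entries of a triangular matrix are eigenvalues, and [L] is similar to [TC]. *)
have eigL i : cmodulus (L i i) < 1.
  apply: Teig; rewrite /complex_eigenvalue -/TC.
  have : eigenvalue L (L i i).
    rewrite eigenvalue_root_char char_poly_trig// rootE horner_prod.
    by rewrite (bigD1 i)//= hornerXsubC subrr mul0r.
  move=> /eigenvalueP[v vL v0]; apply/eigenvalueP; exists (v *m P).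
    rewrite scalemxAl -vL /L.
    by rewrite -!mulmxA mulVmx// mulmx1.
  by apply: contraNneq v0 => vP; rewrite -(mulmxK Pu v) vP mul0mx.
have [t [c [t1 c01 contr]]] := triangular_contraction Ptrig eigL.
have t0 : 0 < t := lt_le_trans ltr01 t1.
pose co (v : 'rV[R]_n) := map_mx (real_complex R) v *m invmx P.
pose N v := \sum_(j < n) t ^+ j * cmodulus (co v 0 j).
pose K1 := \sum_(j < n) t ^+ j * \sum_i cmodulus (invmx P i j).
pose K2 := \sum_i \sum_j cmodulus (P i j).
have tj (j : nat) : 0 <= t ^+ j by rewrite exprn_ge0// ltW.
have K10 : 0 <= K1.
  rewrite sumr_ge0// => i _; rewrite mulr_ge0// sumr_ge0// => j _.
  exact: cmodulus_ge0.
have K2i i : 0 <= \sum_j cmodulus (P i j).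
  by rewrite sumr_ge0// => j _; exact: cmodulus_ge0.
have K20 : 0 <= K2 by rewrite sumr_ge0.
have N0 v : 0 <= N v.
  by rewrite sumr_ge0// => i _; rewrite mulr_ge0// cmodulus_ge0.
(* [K1] controls [invmx P], [K2] controls [P], and 1 makes the common constant positive. *)
exists N, c, (1 + K1 + K2); split => //.
- by lra.
- move=> v w; rewrite /N -big_split ler_sum//= => j _.
  rewrite -mulrDr ler_wpM2l// /co map_mxD mulmxDl mxE; exact: cmodulusD.
- move=> v; rewrite /N /co map_mxM.
  have -> : map_mx (real_complex R) v *m map_mx (real_complex R) T *m invmx P
            = map_mx (real_complex R) v *m invmx P *m L.
    by rewrite /L !mulmxA mulmxKV.
  exact: contr.
move=> v; split.
  apply: (@le_trans _ _ (K1 * `|v|)); last by rewrite ler_wpM2r//; lra.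
  rewrite /N /K1 mulr_suml ler_sum// => j _; rewrite -mulrA ler_wpM2l//.
  apply: le_trans (cmodulus_mulmx _ _ _) _; rewrite mulr_suml ler_sum// => i _.
  rewrite mulrC ler_wpM2l ?cmodulus_ge0// mxE cmodulus_real.
  exact: mx_norm_ge_coord.
apply: (@le_trans _ _ (K2 * N v)); last by rewrite ler_wpM2r//; lra.
apply: mx_norm_le => [|i0 j]; first by rewrite mulr_ge0.
rewrite (ord1 i0) -cmodulus_real.
have -> : (v 0 j)%:C%C = (co v *m P) 0 j by rewrite /co mulmxKV// mxE.
apply: le_trans (cmodulus_mulmx _ _ _) _.
rewrite /N mulr_sumr ler_sum// => i _.
rewrite mulrC mulrA ler_wpM2r ?cmodulus_ge0//.
apply: (@le_trans _ _ K2); last by rewrite ler_peMr// exprn_ege1.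
rewrite /K2 (bigD1 i)//= (bigD1 j)//= -addrA lerDl addr_ge0//.
  by rewrite sumr_ge0// => k _; exact: cmodulus_ge0.
by rewrite sumr_ge0.
Qed.

(** If r = |mu| >= 1, taking moduli gives (r - (1 - alpha))^2 <= alpha^2 r |lambda| < alpha^2 r. But
    the difference of the outer terms factors as (r - 1)(r - (1 - alpha)^2), which is
    nonnegative. *)
Lemma sweep_quadratic_root (R : realType) (alpha : R) (lambda mu : R[i]) :
  0 < alpha <= 1 -> cmodulus lambda < 1 ->
  (mu - (1 - alpha)%:C%C) ^+ 2 = alpha%:C%C ^+ 2 * mu * lambda ->
  cmodulus mu < 1.
Proof.
move=> /andP[a0 a1] l1 eqn; rewrite ltNge; apply/negP => r1.
have tri : cmodulus mu - (1 - alpha) <= cmodulus (mu - (1 - alpha)%:C%C).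
  rewrite lerBlDr -{1}(subrK (1 - alpha)%:C%C mu).
  apply: le_trans (cmodulusD _ _) _.
  by rewrite lerD2l cmodulus_real ger0_norm// subr_ge0.
have := congr1 (@cmodulus R) eqn.
rewrite !expr2 !cmodulusM cmodulus_real (gtr0_norm a0).
have := cmodulus_ge0 lambda.
move: (cmodulus mu) (cmodulus lambda) (cmodulus (mu - _)) r1 l1 tri => r l x.
move=> r1 l1 tri l0 xx.
have : (r - (1 - alpha)) * (r - (1 - alpha)) <= alpha * alpha * r * l.
  by rewrite -xx ler_pM//; lra.
have : alpha * alpha * r * l < alpha * alpha * r.
  by rewrite gtr_pMr// !mulr_gt0//; lra.
have : 0 <= (r - 1) * (r - (1 - alpha) * (1 - alpha)).
  by rewrite mulr_ge0//; nra.
lra.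
Qed.

(** Acts from the right on rows (u, m). The second block column comes from inserting u' = (1 -
    alpha) u - alpha m A into the formula for m', whence the term in [A *m C]. *)
Definition sweep_mx (R : realType) (q : nat) (alpha : R) (A C : 'M[R]_q) :
    'M[R]_(q + q) :=
  block_mx (1 - alpha)%:M (- (alpha * (1 - alpha)) *: C)
    (- alpha *: A) ((1 - alpha)%:M + (alpha ^+ 2) *: (A *m C)).

(** With b = 1 - alpha, an eigenrow (u, m) satisfies (mu - b) u = - alpha m A and (mu - b) m = -
    alpha mu u C. Eliminating u gives (mu - b)^2 m = alpha^2 mu m A C. *)
Lemma sweep_mx_eigenvalue (R : realType) (q : nat) (alpha : R)
    (A C : 'M[R]_q) (mu : R[i]) :
  0 < alpha <= 1 ->
  (forall l, complex_eigenvalue (A *m C) l -> cmodulus l < 1) ->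
  complex_eigenvalue (sweep_mx alpha A C) mu -> cmodulus mu < 1.
Proof.
move=> a01 ACeig /eigenvalueP[v]; rewrite -(hsubmxK v).
move: (lsubmx v) (rsubmx v) => u m.
rewrite map_block_mx mul_row_block scale_row_mx => /eq_row_mx[].
rewrite map_mxD !map_mxZ map_mxM !map_scalar_mx /= => equ eqm um0.
move: a01 ACeig => /[dup] /andP[a0 a1] a01 ACeig.
(* The value 0 is set apart because [lambda] is obtained by dividing by [a ^+ 2 * mu]. *)
have [->|mu0] := eqVneq mu 0; first by rewrite cmodulus0.
set a : R[i] := alpha%:C%C; set b : R[i] := (1 - alpha)%:C%C.
have a0C : a != 0 by rewrite fmorph_eq0 gt_eqF.
move: equ eqm; set A' := map_mx _ A; set C' := map_mx _ C.
rewrite rmorphN rmorphXn rmorphN rmorphM /= -/a -/b.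
rewrite mulmxDr !mul_mx_scalar -!scalemxAr mulmxA => equ eqm.
have {}equ : (mu - b) *: u = - a *: (m *m A').
  by rewrite scalerBl -equ addrAC subrr add0r.
have hAC : a *: (m *m A' *m C') = - (mu - b) *: (u *m C').
  by rewrite scalemxAl -[a *: _]opprK -scaleNr -equ -scaleNr -scalemxAl.
have {}eqm : (mu - b) *: m = - (a * mu) *: (u *m C').
  rewrite scalerBl -eqm expr2 -[(a * a) *: _]scalerA hAC scalerA addrA addrAC.
  by rewrite addrK -scalerDl; congr (_ *: _); ring.
have sq : (mu - b) ^+ 2 *: m = (a ^+ 2 * mu) *: (m *m (A' *m C')).
  rewrite expr2 -scalerA eqm scalerA [X in X *: _]mulrC -[LHS]scalerA.
  rewrite scalemxAl equ.
  by rewrite -scalemxAl scalerA mulmxA; congr (_ *: _); ring.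
(* If [m] vanishes then [u] does not, and the first block forces mu = 1 - alpha. *)
have [m0|m0] := eqVneq m 0.
  move: equ; rewrite m0 mul0mx scaler0 => /eqP.
  rewrite scaler_eq0 => /orP[|/eqP u0].
    rewrite subr_eq0 => /eqP ->; rewrite /b cmodulus_real ger0_norm; lra.
  by move: um0; rewrite u0 m0 row_mx0 eqxx.
apply: (@sweep_quadratic_root _ alpha ((mu - b) ^+ 2 / (a ^+ 2 * mu))) => //.
  apply: ACeig; apply/eigenvalueP; exists m => //.
  rewrite map_mxM /= -/A' -/C' mulrC -scalerA sq scalerA mulVf ?scale1r//.
  by rewrite mulf_neq0 ?expf_neq0.
by rewrite mulrC divfK// mulf_neq0 ?expf_neq0.
Qed.

(** The characteristic polynomials agree. This carries the spectral hypothesis over to the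
    transpose, which the row-vector convention produces. *)
Lemma complex_eigenvalue_trmx (R : realType) (q : nat) (A : 'M[R]_q) :
  complex_eigenvalue A^T =1 complex_eigenvalue A.
Proof.
move=> l; rewrite /complex_eigenvalue -map_trmx !eigenvalue_root_char.
congr (root _ l); rewrite /char_poly -[RHS]det_tr; congr (\det _).
by rewrite /char_poly_mx raddfB /= tr_scalar_mx -map_trmx.
Qed.

(** * Local solvability *)

Lemma mulmx_norm_le (R : realType) (m n p : nat) (A : 'M[R]_(m, n))
    (B : 'M[R]_(n, p)) : `|A *m B| <= n%:R * (`|A| * `|B|).
Proof.
apply: mx_norm_le => [|i j]; first by rewrite !mulr_ge0.
rewrite mxE (le_trans (ler_norm_sum _ _ _))//.
apply: (@le_trans _ _ (\sum_(k < n) `|A| * `|B|)); last first.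
  by rewrite sumr_const card_ord mulr_natl.
rewrite ler_sum// => k _; by rewrite normrM ler_pM// mx_norm_ge_coord.
Qed.

Lemma mulmx_continuous_r (R : realType) (m n p : nat) (B : 'M[R]_(n, p)) :
  continuous (fun A : 'M[R]_(m, n) => A *m B).
Proof.
apply: (@bounded_linear_continuous _ _ _ (mulmxr B)).
apply/linear_boundedP; near=> r => A /=.
rewrite (le_trans (mulmx_norm_le _ _))// mulrCA mulrC ler_wpM2r//.
Unshelve. all: end_near. Qed.

Lemma diff_coord (R : realType) (m n : nat) (A : 'M[R]_(m, n)) i j :
  'd (fun B : 'M[R]_(m, n) => B i j) A = (fun B => B i j) :> (_ -> R).
Proof.
have lin : linear (fun B : 'M[R]_(m, n) => B i j : R^o).
  by move=> a u v; rewrite !mxE.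
pose fM := GRing.isLinear.Build _ _ _ _ _ lin.
pose f : {linear 'M[R]_(m, n) -> R^o} :=
  HB.pack (fun B : 'M[R]_(m, n) => B i j : R^o) fM.
by rewrite (@diff_lin _ _ _ f)//; exact: coord_continuous.
Qed.

(** The real mean value theorem is applied to each entry of [f] along the segment; in the max norm,
    entrywise bounds suffice. *)
Lemma mean_value_rV (R : realType) (n m : nat) (f : 'rV[R]_n -> 'rV[R]_m)
    (x y : 'rV[R]_n) (e : R) :
  0 <= e -> (forall z, differentiable f z) ->
  (forall t, 0 <= t <= 1 -> `|'d f (x + t *: (y - x)) (y - x)| <= e) ->
  `|f y - f x| <= e.
Proof.
move=> e0 fdiff dfe; apply: mx_norm_le => // i j.
pose l (t : R) := x + t *: (y - x).
have ldiff t : is_diff t l ( *:%R ^~ (y - x)).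
  rewrite /l; apply: is_diff_eq; rewrite funeqE => s /=.
  by rewrite [LHS]add0r.
pose g (t : R) := f (l t) i j.
have gdiff t : is_diff t g (fun s => 'd f (l t) (s *: (y - x)) i j).
  have fl := differentiableP (fdiff (l t)).
  have fc : is_diff (f (l t)) (fun B : 'rV[R]_m => B i j : R)
      ((fun B : 'rV[R]_m => B i j : R)).
    by apply: DiffDef; [exact: differentiable_coord|rewrite diff_coord].
  have h := is_diff_comp (is_diff_comp (ldiff t) fl) fc.
  exact: h.
have gderiv (t : R) : is_derive t (1 : R) g ('d f (l t) (y - x) i j).
  apply: DeriveDef; first exact/diff_derivable.
  by rewrite deriveE// diff_val scale1r.
have gcont : {within `[0, 1], continuous g}.
  by apply: continuous_subspaceT => t; exact: differentiable_continuous.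
have [c c01] := MVT ltr01 (fun t _ => gderiv t) gcont.
rewrite /g /l scale1r scale0r addr0 subr0 mulr1 (addrC x) subrK !mxE => ->.
rewrite (le_trans (mx_norm_ge_coord _ _ _))// dfe//.
by rewrite !ltW ?(itvP c01).
Qed.

(** * Partial derivatives and first-order expansion *)

Lemma diff_partial1 (R : realType) (q : nat)
    (F : 'rV[R]_q * 'rV[R]_q -> 'rV[R]_q) (z : 'rV[R]_q * 'rV[R]_q) :
  differentiable F z ->
  is_diff (z.1) (fun U => F (U, z.2)) (fun h => h *m (partial1 F z)^T) /\
  forall h, 'd F z (h, 0) = h *m (partial1 F z)^T.
Proof.
case: z => U M /= Fz.
have Fd := differentiableP Fz.
have id0 : is_diff U (fun V : 'rV[R]_q => (V, M)) (fun h => (h, 0)).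
  by apply: is_diff_eq; rewrite funeqE.
have FU := is_diff_comp id0 Fd.
have E h : 'd F (U, M) (h, 0) = h *m (partial1 F (U, M))^T.
  rewrite /partial1 trmxK /jacobian mul_rV_lin1 /=.
  by rewrite [X in _ = X h](diff_val (is_diff_def := FU)).
split=> //; apply: DiffDef; first exact: (ex_diff (is_diff_def := FU)).
by rewrite [LHS](diff_val (is_diff_def := FU)); apply/funext => h /=; exact: E.
Qed.

Lemma diff_partial2 (R : realType) (q : nat)
    (F : 'rV[R]_q * 'rV[R]_q -> 'rV[R]_q) (z : 'rV[R]_q * 'rV[R]_q) :
  differentiable F z -> forall k, 'd F z (0, k) = k *m (partial2 F z)^T.
Proof.
case: z => U M /= Fz k.
have Fd := differentiableP Fz.
have id0 : is_diff M (fun V : 'rV[R]_q => (U, V)) (fun h => (0, h)).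
  by apply: is_diff_eq; rewrite funeqE.
have FU := is_diff_comp id0 Fd.
rewrite /partial2 trmxK /jacobian mul_rV_lin1 /=.
by rewrite [X in _ = X k](diff_val (is_diff_def := FU)).
Qed.

Lemma diff_partials (R : realType) (q : nat)
    (F : 'rV[R]_q * 'rV[R]_q -> 'rV[R]_q) (z : 'rV[R]_q * 'rV[R]_q) h k :
  differentiable F z ->
  'd F z (h, k) = h *m (partial1 F z)^T + k *m (partial2 F z)^T.
Proof.
move=> Fz; rewrite -(diff_partial1 Fz).2 -(diff_partial2 Fz) -linearD /=.
by congr ('d F z _); rewrite -[RHS]/(h + 0, 0 + k) addr0 add0r.
Qed.

Lemma linearization (R : realType) (q : nat)
    (F : 'rV[R]_q * 'rV[R]_q -> 'rV[R]_q) (Us Ms : 'rV[R]_q) (e : R) :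
  differentiable F (Us, Ms) -> F (Us, Ms) = 0 -> 0 < e ->
  exists2 d, 0 < d & forall U M, `|U - Us| < d -> `|M - Ms| < d ->
    `|F (U, M) - ((U - Us) *m (partial1 F (Us, Ms))^T +
                  (M - Ms) *m (partial2 F (Us, Ms))^T)|
    <= e * (`|U - Us| + `|M - Ms|).
Proof.
move=> Fz F0 e0.
have /diff_locally/eqaddoP/(_ e e0)/nbhs_norm0P[d /= d0 Hd] := Fz.
exists d => // U M Ud Md.
have := Hd (U - Us, M - Ms); rewrite prod_normE /= gt_max Ud Md => /(_ isT).
rewrite -diff_partials//.
rewrite [X in `|X| <= _](_ : _ = F (U, M) - 'd F (Us, Ms) (U - Us, M - Ms)).
  move=> /le_trans; apply; rewrite ler_wpM2l ?(ltW e0)//.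
  by rewrite ge_max lerDl lerDr !normr_ge0.
rewrite -[LHS]/(F (U - Us + Us, M - Ms + Ms) -
  (F (Us, Ms) + 'd F (Us, Ms) (U - Us, M - Ms))).
by rewrite F0 add0r !subrK.
Qed.

(** Expresses the derivative of the simplified Newton map through the variation [P - X] of the
    partial Jacobian, which continuity makes small. *)
Lemma mulmx_sub_right_inverse (R : pzRingType) (m n : nat) (h : 'M[R]_(m, n))
    (P X Q : 'M[R]_n) :
  P^T *m Q = 1%:M -> h - h *m X^T *m Q = h *m (P - X)^T *m Q.
Proof.
by move=> PQ; rewrite raddfB /= mulmxBr mulmxBl -(mulmxA h P^T) PQ mulmx1.
Qed.

(* The simplified Newton map U |-> U - F (U, M) Fu^-T is a 1/2-contraction near
   Us, uniformly in M near Ms. *)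
Lemma newton_contraction (R : realType) (q : nat)
    (F : 'rV[R]_q * 'rV[R]_q -> 'rV[R]_q) (Us Ms : 'rV[R]_q) :
  continuously_differentiable F -> partial1 F (Us, Ms) \in unitmx ->
  exists2 e, 0 < e & forall U V M, `|U - Us| < e -> `|V - Us| < e ->
    `|M - Ms| < e ->
    `|(V - F (V, M) *m invmx (partial1 F (Us, Ms))^T) -
      (U - F (U, M) *m invmx (partial1 F (Us, Ms))^T)| <= 2^-1 * `|V - U|.
Proof.
move=> [Fd Fc _]; set P := partial1 F (Us, Ms) => Pu.
set Q := invmx P^T.
have PQ : P^T *m Q = 1%:M by rewrite mulmxV// unitmx_tr.
clearbody Q.
(* The derivative is a product of three matrices, so its norm is at most q^2 |h| |P - X| |Q|; with
   |P - X| <= 1/(2K) this is at most |h|/2. *)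
pose K : R := q%:R * (q%:R * `|Q|) + 1.
have K0 : 0 < K by rewrite ltr_wpDl// !mulr_ge0.
have K2 : 0 < (2 * K)^-1 by rewrite invr_gt0 mulr_gt0.
have /cvgrPdist_le/(_ _ K2)/nbhs_normP[e /= e0 He] := Fc (Us, Ms).
exists e => // U V M Ue Ve Me.
pose f W := W - F (W, M) *m Q.
have fdiff W : is_diff W f (fun h => h - h *m (partial1 F (W, M))^T *m Q).
  have [FW _] := diff_partial1 (Fd (W, M)).
  have mQ : is_diff (F (W, M)) (fun A : 'rV[R]_q => A *m Q) (mulmxr Q).
    have cQ := @mulmx_continuous_r R 1 q q Q.
    apply: DiffDef; first exact: (@linear_differentiable _ _ _ (mulmxr Q)).
    exact: (@diff_lin _ _ _ (mulmxr Q)).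
  have FQ := is_diff_comp FW mQ.
  exact: is_diffB.
rewrite -/(f V) -/(f U).
apply: mean_value_rV => // t /andP[t0 t1].
rewrite diff_val; set W := U + _; set h := V - U.
(* Convexity of the ball keeps the segment inside it. *)
have WUs : `|W - Us| < e.
  have -> : W - Us = (1 - t) *: (U - Us) + t *: (V - Us).
    by rewrite /W; apply/rowP => j; rewrite !mxE; ring.
  rewrite (le_lt_trans (ler_normD _ _))// !normrZ !ger0_norm//; last by lra.
  pose m := Num.max `|U - Us| `|V - Us|.
  have me : m < e by rewrite gt_max Ue.
  have mU : (1 - t) * `|U - Us| <= (1 - t) * m.
    by rewrite ler_wpM2l ?subr_ge0// le_max lexx.
  have mV : t * `|V - Us| <= t * m by rewrite ler_wpM2l// le_max lexx orbT.
  lra.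
have -> : h - h *m (partial1 F (W, M))^T *m Q =
          h *m (P - partial1 F (W, M))^T *m Q.
  exact: mulmx_sub_right_inverse.
have HW : `|P - partial1 F (W, M)| <= (2 * K)^-1.
  apply: (He (W, M)); rewrite /ball_ /= prod_normE /= gt_max.
  by rewrite distrC WUs distrC.
have trn : `|(P - partial1 F (W, M))^T| <= (2 * K)^-1.
  apply: mx_norm_le => [|i j]; first exact: ltW.
  by rewrite mxE (le_trans _ HW)// mx_norm_ge_coord.
rewrite (le_trans (mulmx_norm_le _ _))//.
apply: (@le_trans _ _ (q%:R * ((q%:R * (`|h| * (2 * K)^-1)) * `|Q|))).
  rewrite ler_wpM2l// ler_wpM2r// (le_trans (mulmx_norm_le _ _))//.
  by rewrite !ler_wpM2l.
rewrite [leLHS](_ : _ = (q%:R * (q%:R * `|Q|)) / K * 2^-1 * `|h|); last first.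
  by rewrite invfM; ring.
rewrite ler_wpM2r// ler_piMl// ler_pdivrMr// mul1r /K.
by rewrite lerDl.
Qed.

(** Completeness of matrices, in the form used by the Banach fixed-point theorem. *)
HB.instance Definition _ (R : realType) (m n : nat) :=
  Complete.on 'M[R]_(m, n).

(** Solutions are the fixed points of the Newton map: contraction gives uniqueness, and the Banach
    theorem on a small closed ball gives existence. The freedom in [r] says that the solution tends
    to [Us] as [M] tends to [Ms]. *)
Lemma local_solvability (R : realType) (q : nat)
    (F : 'rV[R]_q * 'rV[R]_q -> 'rV[R]_q) (Us Ms : 'rV[R]_q) :
  continuously_differentiable F -> F (Us, Ms) = 0 ->
  partial1 F (Us, Ms) \in unitmx ->
  exists2 e, 0 < e &
    (forall U V M, `|U - Us| < e -> `|V - Us| < e -> `|M - Ms| < e ->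
      F (U, M) = 0 -> F (V, M) = 0 -> U = V) /\
    (forall r, 0 < r -> exists2 d, 0 < d & forall M, `|M - Ms| < d ->
      exists2 U, `|U - Us| < r & F (U, M) = 0).
Proof.
move=> FC1 F0 Pu; have [e e0 contr] := newton_contraction FC1 Pu.
move: contr; set Q := invmx _ => contr.
have Qu : Q \in unitmx by rewrite unitmx_inv unitmx_tr.
exists e => //; split.
  move=> U V M Ue Ve Me FU FV; have := contr U V M Ue Ve Me.
  rewrite FU FV mul0mx !subr0 => h.
  apply/esym/eqP; rewrite -subr_eq0 -normr_le0; lra.
move=> r0 r0_gt0; pose r := Num.min (r0 / 2) (e / 2).
have r_gt0 : 0 < r by rewrite lt_min !divr_gt0.
have re : r < e by rewrite gt_min orbC ltr_pdivrMr// ltr_pMr// ltr1n.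
have rr0 : r < r0 by rewrite gt_min ltr_pdivrMr// ltr_pMr// ltr1n.
have [Fd _ _] := FC1.
(* The Newton map moves the centre [Us] by [F (Us, M) *m Q], which is small for [M] near [Ms]. *)
have FMQ : (fun M => F (Us, M) *m Q) @ Ms --> (0 : 'rV[R]_q).
  have -> : (0 : 'rV[R]_q) = F (Us, Ms) *m Q by rewrite F0 mul0mx.
  apply: (@continuous_comp _ _ _ (fun M => F (Us, M)) (fun A => A *m Q)).
    apply: (@continuous_comp _ _ _ (fun M => (Us, M)) F).
      apply: (@cvg_pair _ _ _ (nbhs Ms) (nbhs Us) (nbhs Ms)).
        exact: cvg_cst.
      exact: cvg_id.
    exact: (differentiable_continuous (Fd (Us, Ms))).
  exact: mulmx_continuous_r.
have r2 : 0 < r / 2 by rewrite divr_gt0.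
have /cvgr_dist_le/(_ _ r2)/nbhs_normP[d /= d0 Hd] := FMQ.
exists (Num.min d e); first by rewrite lt_min d0.
move=> M; rewrite lt_min => /andP[Md Me].
pose B := [set U : 'rV[R]_q | `|U - Us| <= r].
pose f W := W - F (W, M) *m Q.
(* Half of the radius is spent on the contraction, the other half on the displacement of the
   centre. *)
have fB : set_fun B B f.
  move=> U; rewrite /B /= => UB.
  have -> : f U - Us = (f U - f Us) + (f Us - Us) by rewrite addrA subrK.
  rewrite (le_trans (ler_normD _ _))//.
  have h1 : `|f U - f Us| <= 2^-1 * `|U - Us|.
    by apply: contr => //; rewrite ?subrr ?normr0// (le_lt_trans UB).
  have h2 : `|f Us - Us| <= r / 2.
    rewrite /f addrAC subrr add0r -[leLHS]/(`|- (F (Us, M) *m Q)|) -sub0r.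
    by apply: (Hd M); rewrite /= distrC.
  by lra.
pose fM := isFun.Build _ _ B B f fB.
pose fF : {fun B >-> B} := HB.pack f fM.
have half_ge0 : 0 <= 2^-1 :> R by rewrite invr_ge0.
have fcontr : is_contraction fF.
  exists (NngNum half_ge0); split=> /=; first by rewrite invf_lt1// ltr1n.
  move=> [U V] /= [UB VB]; apply: contr => //; exact: le_lt_trans re.
have clB : closed B.
  rewrite (_ : B = closed_ball_ Num.norm Us r).
    exact: closed_closed_ball_.
  by apply/seteqP; split => U; rewrite /B /closed_ball_ /= distrC.
have [|U UB Ufix] := banach_fixed_point fcontr clB.
  by exists Us; rewrite /B /= subrr normr0 ltW.
exists U; first exact: le_lt_trans rr0.
have : F (U, M) *m Q = 0.
  have : U = U - F (U, M) *m Q by exact: Ufix.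
  by move=> /(congr1 (fun W => U - W)); rewrite subrr opprB addrCA subrr addr0.
by move=> FQ; rewrite -(mulmxK Qu (F (U, M))) FQ mul0mx.
Qed.

(** [X] is the ball where solutions are unique, and [P] is small enough for a solution to exist in
    it. *)
Lemma local_resolution_exists (R : realType) (q : nat)
    (F : 'rV[R]_q * 'rV[R]_q -> 'rV[R]_q) (Us Ms : 'rV[R]_q) :
  continuously_differentiable F -> F (Us, Ms) = 0 ->
  partial1 F (Us, Ms) \in unitmx ->
  exists P X, local_resolution (fun M U => F (U, M)) Ms Us P X.
Proof.
move=> FC1 F0 Pu; have [e e0 [uniq_sol exist]] := local_solvability FC1 F0 Pu.
have [d d0 Hd] := exist e e0.
exists (ball Ms (Num.min d e)), (ball Us e); split.
- by apply: nbhsx_ballx; rewrite lt_min d0.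
- exact: nbhsx_ballx.
move=> M; rewrite -ball_normE /= distrC lt_min => /andP[Md Me].
have [U Ue FU] := Hd M Md.
exists U; split; first by split=> //; rewrite distrC.
move=> V /= [+ FV]; rewrite distrC => Ve.
exact: (uniq_sol U V M).
Qed.

(* Any resolution selects, near the base point, the solution that is close to
   Us, because its solution is unique; this gives its first-order expansion. *)
Lemma resolution_expansion (R : realType) (q : nat)
    (F : 'rV[R]_q * 'rV[R]_q -> 'rV[R]_q) (Us Ms : 'rV[R]_q) (F1 F2 : 'M[R]_q)
    (P X : set 'rV[R]_q) (eta : R) :
  (forall e, 0 < e -> exists2 d, 0 < d &
    forall U M, `|U - Us| < d -> `|M - Ms| < d ->
      `|F (U, M) - ((U - Us) *m F1 + (M - Ms) *m F2)|
      <= e * (`|U - Us| + `|M - Ms|)) ->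
  (forall r, 0 < r -> exists2 d, 0 < d & forall M, `|M - Ms| < d ->
      exists2 U, `|U - Us| < r & F (U, M) = 0) ->
  F1 \in unitmx ->
  local_resolution (fun M U => F (U, M)) Ms Us P X -> 0 < eta ->
  exists2 d, 0 < d & forall M, `|M - Ms| < d ->
    P M /\ forall U, X U -> F (U, M) = 0 ->
      `|U - Us + (M - Ms) *m (F2 *m invmx F1)| <= eta * `|M - Ms|.
Proof.
move=> lin exist F1u [PMs XUs sol] eta0.
pose a := q%:R * `|F2 *m invmx F1|.
pose k := q%:R * `|invmx F1| + 1.
have a0 : 0 <= a by rewrite mulr_ge0.
have k0 : 0 < k by rewrite ltr_wpDl// mulr_ge0.
(* The first bound absorbs |h| and yields |h| <= (2a + 1)|m|; the second then brings k c (|h| + |m|)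
   below eta |m|. *)
pose c := Num.min (2^-1 / k) (eta / (k * (2 * a + 2))).
have c0 : 0 < c by rewrite lt_min !divr_gt0// mulr_gt0//; lra.
have ck1 : k * c <= 2^-1 by rewrite mulrC -ler_pdivlMr// ge_min lexx.
have ck2 : k * c * (2 * a + 2) <= eta.
  rewrite mulrC mulrA mulrC [_ * k]mulrC.
  by rewrite -ler_pdivlMr ?ge_min ?lexx ?orbT// mulr_gt0//; lra.
have [r r0 Hr] := lin c c0.
have /nbhs_ballP[s s0 Xs] := XUs.
have /nbhs_ballP[t t0 Pt] := PMs.
(* Within [r] the linearization is valid; within [s] the nearby solution lies in [X]. *)
have rs : 0 < Num.min r s by rewrite lt_min r0.
have [d d0 Hd] := exist _ rs.
exists (Num.min d (Num.min r t)); first by rewrite !lt_min d0 r0.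
move=> M; rewrite !lt_min => /and3P[Md Mr Mt].
have PM : P M by apply: Pt; rewrite -ball_normE /= distrC.
split=> // U XU FU.
have [V] := Hd M Md; rewrite lt_min => /andP[Vr Vs] FV.
have XV : X V by apply: Xs; rewrite -ball_normE /= distrC.
have UV : U = V.
  by have [W [_ uniqW]] := sol M PM; rewrite -(uniqW U)// -(uniqW V).
rewrite -{}UV in Vr; have := Hr U M Vr Mr; rewrite FU sub0r normrN.
set h := U - Us; set m := M - Ms => hm.
have E : h + m *m (F2 *m invmx F1) = (h *m F1 + m *m F2) *m invmx F1.
  by rewrite mulmxDl mulmxK// mulmxA.
have bound : `|h + m *m (F2 *m invmx F1)| <= k * c * (`|h| + `|m|).
  rewrite E (le_trans (mulmx_norm_le _ _))// -mulrA.
  rewrite [leLHS](_ : _ = q%:R * `|invmx F1| * `|h *m F1 + m *m F2|);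
    last by ring.
  rewrite ler_pM// ?mulr_ge0//.
  by rewrite /k lerDl.
have mA : `|m *m (F2 *m invmx F1)| <= a * `|m|.
  by rewrite (le_trans (mulmx_norm_le _ _))// /a; lra.
have hle : `|h| <= (2 * a + 1) * `|m|.
  have h1 : `|h| <= `|h + m *m (F2 *m invmx F1)| + `|m *m (F2 *m invmx F1)|.
    by rewrite -{1}(addrK (m *m (F2 *m invmx F1)) h) ler_normB.
  have h2 : k * c * (`|h| + `|m|) <= 2^-1 * (`|h| + `|m|).
    by rewrite ler_wpM2r// addr_ge0.
  lra.
rewrite (le_trans bound)//.
apply: (@le_trans _ _ (k * c * (2 * a + 2) * `|m|)); last by rewrite ler_wpM2r.
rewrite -[leRHS]mulrA ler_wpM2l//; first by rewrite mulr_ge0// ltW.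
by lra.
Qed.

Lemma local_resolution_expansion (R : realType) (q : nat)
    (F : 'rV[R]_q * 'rV[R]_q -> 'rV[R]_q) (Us Ms : 'rV[R]_q)
    (P X : set 'rV[R]_q) (eta : R) :
  continuously_differentiable F -> F (Us, Ms) = 0 ->
  partial1 F (Us, Ms) \in unitmx ->
  local_resolution (fun M U => F (U, M)) Ms Us P X -> 0 < eta ->
  exists2 d, 0 < d & forall M, `|M - Ms| < d ->
    P M /\ forall U, X U -> F (U, M) = 0 ->
      `|U - Us + (M - Ms) *m ((partial2 F (Us, Ms))^T *m
                               invmx (partial1 F (Us, Ms))^T)|
      <= eta * `|M - Ms|.
Proof.
move=> FC1 F0 Pu; have [Fd _ _] := FC1.
have [e _ [_ exist]] := local_solvability FC1 F0 Pu.
apply: resolution_expansion exist _; last by rewrite unitmx_tr.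
by move=> c; exact: linearization (Fd (Us, Ms)) F0.
Qed.

(** Exchanging the arguments lets the results on solving for the first argument apply to [G], which
    is solved for its second. *)
Lemma continuously_differentiable_swap (R : realType) (q : nat)
    (G : 'rV[R]_q * 'rV[R]_q -> 'rV[R]_q) :
  continuously_differentiable G ->
  continuously_differentiable (fun z => G (z.2, z.1)).
Proof.
pose sw (z : 'rV[R]_q * 'rV[R]_q) := (z.2, z.1).
have swc : continuous sw by exact: swap_continuous.
move=> [Gd G1 G2]; split.
- move=> z; apply: (@differentiable_comp _ _ _ _ sw G); last exact: Gd.
  apply: differentiable_pair.
    by apply: (@linear_differentiable _ _ _ snd) => w; exact: cvg_snd.
  by apply: (@linear_differentiable _ _ _ fst) => w; exact: cvg_fst.
- have -> : partial1 (fun z => G (z.2, z.1)) = partial2 G \o sw.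
    by apply/funext => -[].
  by move=> z; apply: continuous_comp; [exact: swc|exact: G2].
- have -> : partial2 (fun z => G (z.2, z.1)) = partial1 G \o sw.
    by apply/funext => -[].
  by move=> z; apply: continuous_comp; [exact: swc|exact: G1].
Qed.

(** * Convergence of the sweeping iteration *)

Lemma norm_row_mx_l (R : realType) (m n1 n2 : nat) (A : 'M[R]_(m, n1))
    (B : 'M[R]_(m, n2)) : `|A| <= `|row_mx A B|.
Proof.
by apply: mx_norm_le => // i j; rewrite -(row_mxEl A B) mx_norm_ge_coord.
Qed.

Lemma norm_row_mx_r (R : realType) (m n1 n2 : nat) (A : 'M[R]_(m, n1))
    (B : 'M[R]_(m, n2)) : `|B| <= `|row_mx A B|.
Proof.
by apply: mx_norm_le => // i j; rewrite -(row_mxEr A B) mx_norm_ge_coord.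
Qed.

Lemma norm_row_mx_le (R : realType) (m n1 n2 : nat) (A : 'M[R]_(m, n1))
    (B : 'M[R]_(m, n2)) : `|row_mx A B| <= `|A| + `|B|.
Proof.
apply: mx_norm_le => [|i j]; first exact: addr_ge0.
rewrite mxE; case: splitP => k _.
  by rewrite (le_trans (mx_norm_ge_coord _ _ _))// lerDl.
by rewrite (le_trans (mx_norm_ge_coord _ _ _))// lerDr.
Qed.

(** Ensures that the relaxed new U stays where the second equation can be resolved. *)
Lemma norm_half_sweep_le (R : realType) (q : nat) (A : 'M[R]_q)
    (alpha eta : R) (u m un : 'rV[R]_q) :
  0 < alpha <= 1 -> 0 < eta <= 1 -> `|un + m *m A| <= eta * `|m| ->
  `|alpha *: un + (1 - alpha) *: u| <=
    (q%:R * `|A| + 2) * `|row_mx u m|.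
Proof.
move=> /andP[a0 a1] /andP[e0 e1] hun.
have um := norm_row_mx_l u m; have mm := norm_row_mx_r u m.
rewrite (le_trans (ler_normD _ _))// !normrZ (gtr0_norm a0).
rewrite ger0_norm ?subr_ge0//.
have unle : `|un| <= `|un + m *m A| + `|m *m A|.
  by rewrite -{1}(addrK (m *m A) un) ler_normB.
have mA := mulmx_norm_le m A.
have em : eta * `|m| <= `|m| by rewrite ler_piMl.
have h1 : alpha * `|un| <= `|un| by rewrite ler_piMl.
have h2 : (1 - alpha) * `|u| <= `|u| by rewrite ler_piMl//; lra.
have h3 : q%:R * `|A| * `|m| <= q%:R * `|A| * `|row_mx u m|.
  by rewrite ler_wpM2l// mulr_ge0.
lra.
Qed.

(** If e1 and e2 are the errors of the two linearized solves, the sweep error is (alpha e1, alpha e2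
    - alpha^2 e1 C): the first error reaches the second component through u'. The constant adds 1
    for e1, q|C| for e1 C, and q|A| + 2 for e2, which is measured against |u'|. *)
Lemma norm_sweep_error_le (R : realType) (q : nat) (A C : 'M[R]_q)
    (alpha eta : R) (u m un mn u' m' : 'rV[R]_q) :
  0 < alpha <= 1 -> 0 < eta <= 1 ->
  `|un + m *m A| <= eta * `|m| -> u' = alpha *: un + (1 - alpha) *: u ->
  `|mn + u' *m C| <= eta * `|u'| -> m' = alpha *: mn + (1 - alpha) *: m ->
  `|row_mx u' m' - row_mx u m *m sweep_mx alpha A C| <=
    eta * (q%:R * `|A| + q%:R * `|C| + 3) * `|row_mx u m|.
Proof.
move=> a01 e01 hun Eu hmn Em.
have u'le : `|u'| <= (q%:R * `|A| + 2) * `|row_mx u m|.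
  by rewrite Eu (norm_half_sweep_le u a01 e01 hun).
move: hun hmn; set e1 := un + _; set e2 := mn + _ => hun hmn.
have -> : row_mx u' m' - row_mx u m *m sweep_mx alpha A C =
    row_mx (alpha *: e1) (alpha *: e2 - alpha ^+ 2 *: (e1 *m C)).
  have Eun : un = e1 - m *m A by rewrite /e1 addrK.
  have Emn : mn = e2 - u' *m C by rewrite /e2 addrK.
  rewrite mul_row_block opp_row_mx add_row_mx !mulmxDr !mul_mx_scalar.
  rewrite -!scalemxAr Em Emn Eu Eun.
  clearbody e1 e2.
  congr row_mx.
    by apply/rowP => j; rewrite !mxE; ring.
  rewrite mulmxDl -!scalemxAl mulmxBl mulmxA.
  move: (u *m C) (e1 *m C) (m *m A *m C) => uC e1C mAC.
  by apply/rowP => j; rewrite !mxE; ring.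
have /andP[a0 a1] := a01; have /andP[e0 e1'] := e01.
have um := norm_row_mx_l u m; have mm := norm_row_mx_r u m.
rewrite (le_trans (norm_row_mx_le _ _))//.
have h1 : `|alpha *: e1| <= `|e1|.
  by rewrite normrZ gtr0_norm// ler_piMl.
have h2 : `|alpha *: e2 - alpha ^+ 2 *: (e1 *m C)| <= `|e2| + `|e1 *m C|.
  apply: le_trans (ler_normB _ _) _.
  rewrite !normrZ !ger0_norm ?exprn_ge0 ?(ltW a0)//.
  have a2 : alpha ^+ 2 <= 1 by rewrite exprn_ile1// ltW.
  by apply: lerD; rewrite ler_piMl//.
have h3 := mulmx_norm_le e1 C.
have h4 : `|e1| <= eta * `|row_mx u m|.
  by rewrite (le_trans hun)// ler_wpM2l// ltW.
have h5 : q%:R * `|C| * `|e1| <= q%:R * `|C| * (eta * `|row_mx u m|).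
  by rewrite ler_wpM2l// mulr_ge0.
have h6 : eta * `|u'| <= eta * ((q%:R * `|A| + 2) * `|row_mx u m|).
  by rewrite ler_wpM2l// ltW.
lra.
Qed.

(** Since c < 1, the set N < rho is invariant, so steps can be continued forever and the decay
    iterates. [S] is a relation because a sweep is one. *)
Lemma contracting_step_orbits (R : realType) (Z : Type) (S : Z -> Z -> Prop)
    (N : Z -> R) (c rho : R) :
  0 <= c < 1 -> (forall z, 0 <= N z) ->
  (forall z, N z < rho ->
    (exists z', S z z') /\ forall z', S z z' -> N z' <= c * N z) ->
  forall z0, N z0 < rho ->
    (exists z : nat -> Z, z 0%N = z0 /\ forall k, S (z k) (z k.+1)) /\
    (forall z : nat -> Z, z 0%N = z0 -> (forall k, S (z k) (z k.+1)) ->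
      forall k, N (z k) <= c ^+ k * N z0).
Proof.
move=> /andP[c0 c1] N0 step z0 z0rho; split.
  (* Outside the invariant set [z] itself is a dummy successor, never reached from [z0]. *)
  have /choice[f Hf] : forall z, exists z', N z < rho -> S z z'.
    move=> z; have [/step[[z' Sz'] _]|?] := ltP (N z) rho; first by exists z'.
    by exists z.
  exists (fun k => iter k f z0); split=> // k; apply: (Hf).
  elim: k => //= k IH; have [_ contr] := step _ IH.
  rewrite (le_lt_trans (contr _ (Hf _ IH)))// (le_lt_trans _ IH)//.
  by rewrite ler_piMl// ltW.
move=> z zz0 Sz; elim=> [|k IH]; first by rewrite expr0 mul1r zz0.
have zk : N (z k) < rho.
  rewrite (le_lt_trans IH)// (le_lt_trans _ z0rho)// ler_piMl// exprn_ile1//.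
  exact: ltW.
rewrite (le_trans ((step _ zk).2 _ (Sz k)))// exprS -mulrA.
by rewrite ler_wpM2l.
Qed.

(** [A] and [C] enter as the first-order responses of the two solves, up to sign. In the adapted
    norm the linear part contracts by [c], and the nonlinear error raises the factor to at most (1 +
    c)/2. *)
Lemma sweep_converges_locally (R : realType) (q : nat)
    (F G : 'rV[R]_q * 'rV[R]_q -> 'rV[R]_q) (Us Ms : 'rV[R]_q) (alpha : R)
    (A C : 'M[R]_q) (PF XF PG XG : set 'rV[R]_q) :
  0 < alpha <= 1 ->
  (forall l, complex_eigenvalue (A *m C) l -> cmodulus l < 1) ->
  (forall eta, 0 < eta -> exists2 d, 0 < d & forall M, `|M - Ms| < d ->
    PF M /\ forall U, XF U -> F (U, M) = 0 ->
      `|U - Us + (M - Ms) *m A| <= eta * `|M - Ms|) ->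
  (forall eta, 0 < eta -> exists2 d, 0 < d & forall U, `|U - Us| < d ->
    PG U /\ forall M, XG M -> G (U, M) = 0 ->
      `|M - Ms + (U - Us) *m C| <= eta * `|U - Us|) ->
  (forall M, PF M -> exists! U, XF U /\ F (U, M) = 0) ->
  (forall U, PG U -> exists! M, XG M /\ G (U, M) = 0) ->
  converges_locally F G alpha PF XF PG XG (Us, Ms).
Proof.
move=> a01 ACeig expF expG solF solG.
have [N [c [K [/andP[c0 c1] K0 ND contr NK]]]] :=
  adapted_norm (fun l => sweep_mx_eigenvalue a01 (mu := l) ACeig).
pose L := q%:R * `|A| + q%:R * `|C| + 3.
have qA0 : 0 <= q%:R * `|A| by rewrite mulr_ge0.
have qC0 : 0 <= q%:R * `|C| by rewrite mulr_ge0.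
have L0 : 0 < L by rewrite /L; lra.
have K2L : 0 < K * K * L by rewrite !mulr_gt0.
(* The sweep error, converted to [N] and back, costs a factor K eta L K, which this choice keeps
   below half of the gap 1 - c. *)
pose eta := Num.min 1 ((1 - c) / 2 / (K * K * L)).
have eta01 : 0 < eta <= 1.
  by rewrite lt_min ge_min lexx /= ltr01 !divr_gt0// subr_gt0.
have eta0 : 0 < eta by case/andP: eta01.
have etaK : K * (eta * L * K) <= (1 - c) / 2.
  rewrite [leLHS](_ : _ = eta * (K * K * L)); last by ring.
  by rewrite -ler_pdivlMr// ge_min lexx orbT.
have [dF dF0 HF] := expF eta eta0.
have [dG dG0 HG] := expG eta eta0.
pose dev (z : 'rV[R]_q * 'rV[R]_q) := row_mx (z.1 - Us) (z.2 - Ms).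
have N0 v : 0 <= N v.
  by have [_ h] := NK v; rewrite -(pmulr_rge0 _ K0) (le_trans _ h).
(* If N < rho, the deviation is below [dF], so the first equation is resolvable, and after growth by
   q|A| + 2 still below [dG], so the second one is. *)
pose rho := Num.min dF (dG / (q%:R * `|A| + 2)) / K.
have A2 : 0 < q%:R * `|A| + 2 by lra.
have rho0 : 0 < rho by rewrite divr_gt0// lt_min dF0 divr_gt0.
have relax (x y z : 'rV[R]_q) : alpha *: x + (1 - alpha) *: y - z =
    alpha *: (x - z) + (1 - alpha) *: (y - z).
  by apply/rowP => j; rewrite !mxE; ring.
have step z : N (dev z) < rho ->
    (exists z', relaxed_sweep F G alpha PF XF PG XG z z') /\
    forall z', relaxed_sweep F G alpha PF XF PG XG z z' ->
      N (dev z') <= (1 + c) / 2 * N (dev z).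
  move=> zrho; have [_ devK] := NK (dev z).
  have devrho : `|dev z| < Num.min dF (dG / (q%:R * `|A| + 2)).
    by rewrite (le_lt_trans devK)// mulrC -ltr_pdivlMr.
  move: devrho; rewrite lt_min ltr_pdivlMr// => /andP[devF devG].
  have [PFM expM] := HF z.2 (le_lt_trans (norm_row_mx_r _ _) devF).
  (* The second equation is posed with the relaxed U, so that is the point to locate. *)
  have nearU Un : XF Un -> F (Un, z.2) = 0 ->
      `|alpha *: Un + (1 - alpha) *: z.1 - Us| < dG.
    move=> XUn FUn; rewrite relax (le_lt_trans _ devG)// mulrC.
    exact: (norm_half_sweep_le _ a01 eta01 (expM Un XUn FUn)).
  split.
    have [Un [[XUn FUn] _]] := solF _ PFM.
    have [PGU _] := HG _ (nearU Un XUn FUn).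
    have [Mn [[XMn GMn] _]] := solG _ PGU.
    exists (alpha *: Un + (1 - alpha) *: z.1, alpha *: Mn + (1 - alpha) *: z.2).
    by exists Un, Mn.
  move=> z' [Un [Mn [[_ XUn FUn] [E1 [[_ XMn GMn] E2]]]]].
  have z'dG : `|z'.1 - Us| < dG by rewrite E1 nearU.
  have [_ expU] := HG _ z'dG.
  have E1' : z'.1 - Us = alpha *: (Un - Us) + (1 - alpha) *: (z.1 - Us).
    by rewrite E1 relax.
  have E2' : z'.2 - Ms = alpha *: (Mn - Ms) + (1 - alpha) *: (z.2 - Ms).
    by rewrite E2 relax.
  have err := norm_sweep_error_le a01 eta01 (expM Un XUn FUn) E1'
    (expU Mn XMn GMn) E2'.
  rewrite -/(dev z') -/(dev z) -/L in err.
  rewrite -(subrK (dev z *m sweep_mx alpha A C) (dev z')).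
  have h1 := ND (dev z' - dev z *m sweep_mx alpha A C)
    (dev z *m sweep_mx alpha A C).
  have h2 := contr (dev z).
  have [h3 _] := NK (dev z' - dev z *m sweep_mx alpha A C).
  have h4 := ler_wpM2l (ltW K0) err.
  have h5 : K * (eta * L * `|dev z|) <= K * (eta * L * K) * N (dev z).
    rewrite -[leRHS]mulrA -[X in _ <= _ * X]mulrA ler_wpM2l ?(ltW K0)//.
    by rewrite ler_wpM2l// mulr_ge0// ltW.
  have h6 := ler_wpM2r (N0 (dev z)) etaK.
  lra.
have c01 : 0 <= (1 + c) / 2 < 1 by lra.
exists [set z | N (dev z) < rho].
  (* The 2 accounts for the two components of the deviation, [K] for passing to [N]. *)
  have rK0 : 0 < rho / (K * 2) by rewrite (divr_gt0 rho0)// mulr_gt0.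
  apply/nbhs_ballP; exists (rho / (K * 2)) => //.
  move=> [U M] []; rewrite -!ball_normE /= (distrC Us) (distrC Ms) => UM MU.
  have [h _] := NK (dev (U, M)).
  rewrite (le_lt_trans h)// mulrC -ltr_pdivlMr//.
  rewrite (le_lt_trans (norm_row_mx_le _ _))//=.
  by rewrite (lt_le_trans (ltrD UM MU))// invfM mulrA -splitr.
move=> z0 /= z0rho.
have [ex all] := contracting_step_orbits c01 (fun z => N0 (dev z)) step z0rho.
split; first by have [z [zz0 Sz]] := ex; exists z.
move=> z [zz0 Sz]; have geo := all z zz0 Sz.
have /andP[c0' c1'] := c01.
apply/cvgrPdist_le => e e0.
have : geometric (K * N (dev z0)) ((1 + c) / 2) @ \oo --> 0.
  by apply: cvg_geometric; rewrite ger0_norm.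
move=> /cvgrPdist_le/(_ e e0); apply: filterS => k; rewrite sub0r normrN => ke.
have [_ h] := NK (dev (z k)).
have zk : `|dev (z k)| <= e.
  rewrite (le_trans h)// (le_trans _ ke)// /geometric /=.
  rewrite ger0_norm; last by rewrite !mulr_ge0 ?exprn_ge0// ltW.
  by rewrite -mulrA ler_wpM2l ?(ltW K0)// mulrC geo.
rewrite prod_normE /= ge_max distrC (le_trans (norm_row_mx_l _ _) zk)/=.
by rewrite distrC (le_trans (norm_row_mx_r _ _) zk).
Qed.

(** The first two conclusions keep the third, stated for all local resolutions, from being
    vacuous. *)
Theorem proposition2 (R : realType) (q : nat)
    (F G : 'rV[R]_q * 'rV[R]_q -> 'rV[R]_q) (Us Ms : 'rV[R]_q)
    (alpha : R) (lmax : R[i]) :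
  let Fu := partial1 F (Us, Ms) in
  let Fm := partial2 F (Us, Ms) in
  let Gu := partial1 G (Us, Ms) in
  let Gm := partial2 G (Us, Ms) in
  let B := invmx Gm *m Gu *m invmx Fu *m Fm in
  continuously_differentiable F ->
  continuously_differentiable G ->
  F (Us, Ms) = 0 ->
  G (Us, Ms) = 0 ->
  Fu \in unitmx ->
  Gm \in unitmx ->
  0 < alpha <= 1 ->
  largest_eigenvalue B lmax ->
  cmodulus lmax < 1 ->
  0 < alpha < 2 / (1 + spectral_radius B) ->
  [/\ exists PF XF, local_resolution (fun M U => F (U, M)) Ms Us PF XF,
      exists PG XG, local_resolution (fun U M => G (U, M)) Us Ms PG XG &
      forall PF XF PG XG : set 'rV[R]_q,
        local_resolution (fun M U => F (U, M)) Ms Us PF XF ->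
        local_resolution (fun U M => G (U, M)) Us Ms PG XG ->
        converges_locally F G alpha PF XF PG XG (Us, Ms)].
Proof.
move=> Fu Fm Gu Gm B FC1 GC1 F0 G0 Fuu Gmu a01 [_ lmax_max] lmax1 _.
(* The product of the two row-vector responses is the transpose of [B]. *)
have trB (X Y Z W : 'M[R]_q) : X^T *m invmx Y^T *m (Z^T *m invmx W^T) =
    (invmx W *m Z *m invmx Y *m X)^T.
  by rewrite !trmx_mul !trmx_inv !mulmxA.
have G'C1 := continuously_differentiable_swap GC1.
split; first exact: local_resolution_exists FC1 F0 Fuu.
  exact: local_resolution_exists G'C1 G0 Gmu.
move=> PF XF PG XG resF resG.
apply: (@sweep_converges_locally _ _ _ _ _ _ _ (Fm^T *m invmx Fu^T)
  (Gu^T *m invmx Gm^T)).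
- exact: a01.
- move=> l; rewrite trB complex_eigenvalue_trmx => /lmax_max.
  by move=> /le_lt_trans; apply.
- by move=> eta; exact: local_resolution_expansion FC1 F0 Fuu resF.
- by move=> eta; exact: local_resolution_expansion G'C1 G0 Gmu resG.
- by case: resF.
- by case: resG.
Qed.
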